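(* Let $\Lambda\subseteq\mathbb{R}^4$ be the lattice generated by the rows of $$\begin{pmatrix}20 & 53 & -53 & -42 \\ -62 & -22 & 42 & -42 \\ -22 & -22 & -62 & 62 \\ 20 & 53 & 42 & 53\end{pmatrix}.$$ Then the lattice packing of the four-dimensional cross-polytope induced by $\Lambda$ has density $\Delta\approx 0.824858$ (that is, $|\Delta-0.824858|<5\cdot 10^{-7}$), and the kissing number of $\Lambda$ with respect to the $\ell^1$-norm is $30$.
   Context: The four-dimensional cross-polytope is $K_4=\{x\in\mathbb{R}^4:\sum_{i=1}^4|x_i|\le 1\}$. For a lattice $\Lambda\subseteq\mathbb{R}^4$ let $\lambda_1(\Lambda)=\min\{\|x\|_1:x\in\Lambda\setminus\{0\}\}$, with $\|x\|_1=\sum_i|x_i|$, and let $\operatorname{vol}(\Lambda)$ be the absolute value of the determinant of a generator matrix. The density of the induced lattice packing of (suitably scaled) cross-polytopes is $\Delta=\frac{\lambda_1(\Lambda)^4}{4!\,\operatorname{vol}(\Lambda)}$. The kissing number of $\Lambda$ with respect to the $\ell^1$-norm is the number of vectors $x\in\Lambda$ with $\|x\|_1=\lambda_1(\Lambda)$. *)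

(* Defs.v *)
From mathcomp Require Import all_boot all_order all_algebra.
From mathcomp Require Import all_classical all_reals.

Set Implicit Arguments.
Unset Strict Implicit.
Unset Printing Implicit Defensive.

Import Order.TTheory GRing.Theory Num.Theory.

Local Open Scope classical_set_scope.
Local Open Scope ring_scope.

Section CrossPolytopePacking.
Variable R : realType.

Definition norm1 (x : 'rV[R]_4) : R := \sum_(i < 4) `|x 0 i|.

Definition row_span_int (G : 'M[R]_4) : set 'rV[R]_4 :=
  [set x | exists z : 'rV[int]_4, x = map_mx intr z *m G].

Definition is_generator (L : set 'rV[R]_4) (G : 'M[R]_4) : Prop :=
  G \in unitmx /\ L = row_span_int G.

(* The determinant of an arbitrarily chosen generator matrix of L: any two
   differ by a unimodular factor. The value is 0 if L is not a lattice of
   full rank. *)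
Definition lattice_vol (L : set 'rV[R]_4) : R :=
  `|\det (xget 0 (is_generator L))|.

(* The infimum is a minimum when L is a lattice of full rank. *)
Definition lambda1 (L : set 'rV[R]_4) : R :=
  inf [set norm1 x | x in L `\ 0].

(* The cross-polytope of l1-radius r has volume (2 r)^4 / 4!, and r = lambda1 / 2
   is the largest radius whose translates by L form a packing. *)
Definition packing_density (L : set 'rV[R]_4) : R :=
  lambda1 L ^+ 4 / (4`!%:R * lattice_vol L).

Definition minimal_vectors (L : set 'rV[R]_4) : set 'rV[R]_4 :=
  [set x | L x /\ norm1 x = lambda1 L].

Definition has_kissing_number (L : set 'rV[R]_4) (k : nat) : Prop :=
  (minimal_vectors L #= `I_k)%card.

Definition generator_rows : seq (seq int) :=
  [:: [:: 20; 53; - 53; - 42];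
      [:: - 62; - 22; 42; - 42];
      [:: - 22; - 22; - 62; 62];
      [:: 20; 53; 42; 53]].

Definition generator : 'M[R]_4 :=
  \matrix_(i < 4, j < 4) (nth 0 (nth [::] generator_rows i) j)%:~R.

End CrossPolytopePacking.

Arguments generator R : clear implicits.

(* Main.v *)
(* A lattice vector x = z G has integer coordinates z = x G^-1, and the entries
   of G^-1 are so small that |x|_1 <= 168 forces |z_i| <= 2 for all i. Checking
   the 625 integer vectors z in this box shows that the minimum is 168 and that
   it is attained 30 times. Moreover |det G| = 40238960, so the density is
   168^4 / (24 * 40238960) = 0.8248578989... *)
Require Import Defs.
From mathcomp Require Import all_boot all_order all_algebra.
From mathcomp Require Import all_classical all_reals.
From mathcomp Require Import zify ring lra.

Set Implicit Arguments.
Unset Strict Implicit.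
Unset Printing Implicit Defensive.

Import Order.TTheory GRing.Theory Num.Theory.
Local Open Scope ring_scope.

Lemma map_mx_intr_inj (R : numDomainType) (m n : nat) :
  injective (map_mx intr : 'M[int]_(m, n) -> 'M[R]_(m, n)).
Proof.
move=> A B /matrixP AB; apply/matrixP => i j.
by apply: (@intr_inj R); have := AB i j; rewrite !mxE.
Qed.

(** Each matrix is an integer multiple of the other, say [G = U H] and [H = V G]. Cancelling [G]
    gives [U V = 1] over the integers, so [\det U] is a unit of [int]. *)
Lemma generator_norm_det (R : realType) (L : set 'rV[R]_4) (G H : 'M[R]_4) :
  is_generator L G -> is_generator L H -> `|\det G| = `|\det H|.
Proof.
move=> [uG LG] [uH LH].
have sub (A B : 'M[R]_4) : row_span_int A = row_span_int B ->
    exists U : 'M[int]_4, A = map_mx intr U *m B.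
  move=> AB.
  have rowA i : exists z : 'rV[int]_4, row i A = map_mx intr z *m B.
    have : row_span_int A (row i A).
      by exists (delta_mx 0 i); rewrite map_delta_mx -rowE.
    by rewrite AB.
  have [f fP] := choice rowA.
  exists (\matrix_i f i); apply/row_matrixP => i.
  by rewrite fP row_mul -map_row rowK.
have [U GU] := sub G H (etrans (esym LG) LH).
have [V HV] := sub H G (etrans (esym LH) LG).
have UV : U *m V = 1%:M.
  apply: (@map_mx_intr_inj R).
  (* Multiply by [G] and then by its inverse: [U V G = U H = G]. *)
  rewrite map_mxM map_mx1 -[LHS](mulmxK uG) -!mulmxA.
  by rewrite (mulmxA _ G) -HV mulmxA -GU mulmxV.
have detU : `|\det U| = 1.
  have := congr1 (fun M => `|\det M|%N) UV.
  rewrite det_mulmx det1 abszM => /eqP.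
  by rewrite muln_eq1 => /andP[/eqP detU1 _]; rewrite -[LHS]abszE detU1.
by rewrite GU det_mulmx det_map_mx normrM -intr_norm detU mul1r.
Qed.

Lemma lattice_volE (R : realType) (L : set 'rV[R]_4) (G : 'M[R]_4) :
  is_generator L G -> lattice_vol L = `|\det G|.
Proof.
by move=> LG; apply: (generator_norm_det _ LG); apply: xgetPex; exists G.
Qed.

Lemma lambda1E (R : realType) (L : set 'rV[R]_4) (x : 'rV[R]_4) :
  L x -> x != 0 -> (forall y, L y -> y != 0 -> norm1 x <= norm1 y) ->
  lambda1 L = norm1 x.
Proof.
move=> Lx x0 xmin.
have lbx : lbound [set norm1 y | y in L `\ 0]%classic (norm1 x).
  by move=> _ [y [Ly /eqP y0] <-]; exact: xmin.
have nx : [set norm1 y | y in L `\ 0]%classic (norm1 x).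
  by exists x => //; split=> //; apply/eqP.
apply/eqP; rewrite eq_le; apply/andP; split.
  by apply: ge_inf => //; exists (norm1 x).
by apply: lb_le_inf => //; exists (norm1 x).
Qed.

Lemma det_generator (R : realType) : \det (generator R) = - 40238960%:R.
Proof.
set d := RHS. (* keeps [/=] from unfolding the numeral *)
rewrite (expand_det_row _ 0) !big_ord_recl big_ord0 /cofactor.
(* Fixing the sizes 3 and 2 makes each pass expand exactly one level of minors. *)
rewrite !(@expand_det_row _ 3 _ 0) !big_ord_recl !big_ord0 /cofactor.
rewrite !(@expand_det_row _ 2 _ 0) !big_ord_recl !big_ord0 /cofactor.
rewrite !det_mx11 !mxE /=.
by rewrite {}/d; ring.
Qed.

Lemma generator_unit (R : realType) : generator R \in unitmx.
Proof. by rewrite unitmxE det_generator unitfE; apply: ltr0_neq0; lra. Qed.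

(** Indexing by [nth] is injective on positions of a duplicate-free list. The empty list is separate
    because [nth] needs a default element. *)
Lemma card_eq_seq (T : eqType) (s : seq T) :
  uniq s -> ([set` s] #= `I_(size s))%card.
Proof.
case: s => [|x0 s'] us; first by rewrite set_nil II0.
set s := x0 :: s' in us *.
have -> : [set` s]%classic = [set nth x0 s i | i in `I_(size s)]%classic.
  apply/seteqP; split=> [x /(nthP x0)[i ? <-]|_ [i i_s <-]]; first by exists i.
  exact: mem_nth.
by apply: inj_card_eq => i j /set_mem i_s /set_mem j_s /eqP;
  rewrite nth_uniq // => /eqP.
Qed.

(** Nested pairs encode coefficient vectors so that the finite checks can be run by [vm_compute]. *)
Definition coef_row (p : (int * int) * (int * int)) : 'rV[int]_4 :=
  \row_j [:: p.1.1; p.1.2; p.2.1; p.2.2]`_j.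

(** One absolute value per column of [generator], kept in [int] so that it evaluates. *)
Definition coef_norm (p : (int * int) * (int * int)) : int :=
  let: ((a, b), (c, d)) := p in
  `|20 * a - 62 * b - 22 * c + 20 * d| + `|53 * a - 22 * b - 22 * c + 53 * d|
  + `|- 53 * a + 42 * b - 62 * c + 42 * d|
  + `|- 42 * a - 42 * b + 62 * c + 53 * d|.

Definition lattice_vector (R : realType) p : 'rV[R]_4 :=
  map_mx intr (coef_row p) *m generator R.

Lemma coef_row_surj (z : 'rV[int]_4) : exists p, z = coef_row p.
Proof.
exists ((z 0 0, z 0 1), (z 0 2%:R, z 0 3%:R)).
apply/rowP => -[[|[|[|[|]]]] //= lt_j]; rewrite mxE /=; congr (z 0 _);
  exact: val_inj.
Qed.

Lemma coef_row_inj : injective coef_row.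
Proof.
move=> [[a b] [c d]] [[a' b'] [c' d']] /rowP e.
have := (e 0, e 1, e 2%:R, e 3%:R).
by rewrite !mxE /= => -[[[-> ->] ->] ->].
Qed.

Lemma lattice_vector_inj (R : realType) : injective (@lattice_vector R).
Proof.
move=> p q /(can_inj (mulmxK (generator_unit R))) e.
by apply/coef_row_inj/(@map_mx_intr_inj R).
Qed.

Lemma norm1_lattice_vector (R : realType) p :
  norm1 (lattice_vector R p) = (coef_norm p)%:~R.
Proof.
case: p => [[a b] [c d]].
rewrite /norm1 !big_ord_recl big_ord0 !mxE !big_ord_recl !big_ord0 !mxE /=.
have intr_norm4 (m n k l : int) : (`|m| + `|n| + `|k| + `|l|)%:~R =
    `|m%:~R| + (`|n%:~R| + (`|k%:~R| + (`|l%:~R| + 0))) :> R.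
  by rewrite !intrD !intr_norm addr0 !addrA.
rewrite intr_norm4.
by congr (_ + (_ + (_ + (_ + _)))); congr `|_|; ring.
Qed.

Definition coef_box : seq ((int * int) * (int * int)) :=
  let r : seq int := [:: -2; -1; 0; 1; 2] in
  let pairs := [seq (a, b) | a <- r, b <- r] in
  [seq (p, q) | p <- pairs, q <- pairs].

Definition minimal_coefs := [seq p <- coef_box | coef_norm p == 168].

Lemma coef_norm_box p : coef_norm p <= 168 -> p \in coef_box.
Proof.
case: p => [[a b] [c d]] /= le168.
have in_r (x : int) : -2 <= x <= 2 -> x \in [:: -2; -1; 0; 1; 2].
  rewrite !inE; lia.
(* Each coefficient is a combination of the four sums inside the absolute values, with weights from
   a column of the inverse of [generator]. These weights are below 3/168 in absolute value, so the
   coefficient is below 3. *)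
by do 2!apply: allpairs_f; apply: in_r; lia.
Qed.

Lemma coef_norm_ge p : p != 0 -> 168 <= coef_norm p.
Proof.
move=> p0; rewrite leNgt; apply/negP => lt168.
have small : all (fun q => (coef_norm q < 168) ==> (q == 0)) coef_box.
  by vm_compute.
have /(allP small) := coef_norm_box (ltW lt168).
by rewrite lt168 (negPf p0).
Qed.

(** By [coef_norm_box], filtering the finite box loses no vector of norm 168. *)
Lemma minimal_vectorsE (R : realType) :
  lambda1 (row_span_int (generator R)) = 168 ->
  minimal_vectors (row_span_int (generator R)) =
  [set lattice_vector R p | p in [set` minimal_coefs]]%classic.
Proof.
move=> l168; apply/seteqP; split=> [_ [[z ->]]|_ [p /= + <-]].
  rewrite l168; have [p ->] := coef_row_surj z.
  rewrite norm1_lattice_vector (_ : 168 = 168%:~R :> R) // => /intr_inj np.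
  by exists p => //=; rewrite mem_filter np coef_norm_box ?np.
rewrite mem_filter => /andP[/eqP np _]; split; first by exists (coef_row p).
by rewrite l168 norm1_lattice_vector np.
Qed.

Lemma lambda1_generator (R : realType) :
  lambda1 (row_span_int (generator R)) = 168.
Proof.
(* The first row of [generator] attains the minimum: 20 + 53 + 53 + 42 = 168. *)
pose p0 : (int * int) * (int * int) := ((1, 0), (0, 0)).
have np0 : norm1 (lattice_vector R p0) = 168.
  by rewrite norm1_lattice_vector.
have vec0 p : (lattice_vector R p == 0) = (p == 0).
  have {1}<- : lattice_vector R 0 = 0.
    rewrite /lattice_vector (_ : coef_row 0 = 0) ?map_mx0 ?mul0mx //.
    by apply/rowP => -[[|[|[|[|]]]] //= ?]; rewrite !mxE.
  by rewrite (inj_eq (@lattice_vector_inj R)).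
rewrite -np0; apply: lambda1E; first by exists (coef_row p0).
  by rewrite vec0.
move=> _ [z ->]; have [p ->] := coef_row_surj z.
rewrite -/(lattice_vector R p) vec0 np0 norm1_lattice_vector => /coef_norm_ge.
by rewrite -(ler_int R).
Qed.

Theorem mainTheorem5 (R : realType) :
  let L := row_span_int (generator R) in
  `|packing_density L - 824858%:R / 10%:R ^+ 6| < 5%:R / 10%:R ^+ 7
  /\ has_kissing_number L 30.
Proof.
move=> L; split.
  rewrite /packing_density lambda1_generator.
  rewrite (lattice_volE (conj (generator_unit R) erefl)) det_generator normrN.
  have -> : (4`! = 24)%N by [].
  rewrite normr_nat ltr_norml.
  (* Only two inequalities between explicit rationals remain. *)
  by apply/andP; split; lra.
rewrite /has_kissing_number (minimal_vectorsE (lambda1_generator R)).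
(* Injectivity reduces counting real vectors to counting the entries of an integer list. *)
have inj_vec : {in [set` minimal_coefs]%classic &, injective (lattice_vector R)}.
  by move=> p q _ _; exact: lattice_vector_inj.
apply: (card_eq_trans (inj_card_eq inj_vec)).
have <- : size minimal_coefs = 30%N by vm_compute.
by apply: card_eq_seq; vm_compute.
Qed.
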